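(* Let $p\in(1,2)$ and let $B\subset\mathbb{R}^2$ be the open unit disc centered at the origin. For $u\in\mathbb{R}^2$ and $\kappa,\lambda,i,j\in\{1,2\}$ set $$A^{\kappa\lambda}_{ij}(u)=\delta_{\kappa\lambda}\delta_{ij}+\Big(\delta_{\kappa i}+\tfrac{2p}{2-p}\tfrac{u_iu_\kappa}{1+|u|^2}\Big)\Big(\delta_{\lambda j}+\tfrac{2p}{2-p}\tfrac{u_ju_\lambda}{1+|u|^2}\Big),$$ for $z,\bar z\in\mathbb{R}^{2\times2}$ let $A(u)(z,\bar z)=\sum_{\kappa,\lambda,i,j}A^{\kappa\lambda}_{ij}(u)z^\kappa_i\bar z^\lambda_j$ and $(A(u)z)^\lambda_j=\sum_{\kappa,i}A^{\kappa\lambda}_{ij}(u)z^\kappa_i$. Let $g\colon\mathbb{R}\to[0,1]$ be a symmetric smooth function with $\mathbf{1}_{\{0\}}\le g\le\mathbf{1}_{(-1,1)}$, let $m_g=(p-1)^{-1}\big(1+\sup_{s\in\mathbb{R}}\{|g'(s)|+2|g''(s)|s\}\big)$, and $a(u,z)=\big(g(|z|^2)+m_g\,A(u)(z,z)\big)^{\frac{p-2}{2}}A(u)z$. Let $u\colon B\to\mathbb{R}^2$, $u(x)=x/|x|$. Then $u\in W^{1,p}(B,\mathbb{R}^2)\cap L^\infty(B,\mathbb{R}^2)$ and $u$ is a weak solution of $\operatorname{div} a(u,Du)=0$ in $B$, i.e. $\int_B a(u,Du)\cdot D\varphi\,dx=0$ for all $\varphi\in C^\infty_c(B,\mathbb{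R}^2)$.
   Context: $\delta$ is the Kronecker delta, $\mathbf{1}_X$ the indicator function of $X$, $|z|$ the Euclidean norm on $\mathbb{R}^{2\times2}$. *)

(* Defs.v *)
From HB Require Import structures.
From mathcomp Require Import all_boot all_order all_algebra.
From mathcomp Require Import all_classical all_reals all_analysis.
Set Implicit Arguments. Unset Strict Implicit. Unset Printing Implicit Defensive.
Import Order.TTheory GRing.Theory Num.Theory.
Import numFieldNormedType.Exports.
Local Open Scope classical_set_scope.
Local Open Scope ring_scope.

Section Defs.
Variable R : realType.

Definition leb2 := (@lebesgue_measure R \x @lebesgue_measure R)%E.

Definition coord2 (x : R * R) (i : 'I_2) : R := if i == ord0 then x.1 else x.2.

Definition sqnorm2 (u : 'I_2 -> R) : R := \sum_(i < 2) u i ^+ 2.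
Definition sqnormM (z : 'I_2 -> 'I_2 -> R) : R := \sum_(k < 2) \sum_(i < 2) z k i ^+ 2.

Definition Bdisc : set (R * R) := [set x | x.1 ^+ 2 + x.2 ^+ 2 < 1].

Definition kdelta (i j : 'I_2) : R := if i == j then 1 else 0.

Definition pderiv (i : 'I_2) (f : R * R -> R) : R * R -> R :=
  fun x => if i == ord0 then derive1 (fun t => f (t, x.2)) x.1
           else derive1 (fun t => f (x.1, t)) x.2.
Definition pderivable (i : 'I_2) (f : R * R -> R) (x : R * R) : Prop :=
  if i == ord0 then derivable (fun t => f (t, x.2)) x.1 1
  else derivable (fun t => f (x.1, t)) x.2 1.

Fixpoint pderivs (ds : seq 'I_2) (f : R * R -> R) : R * R -> R :=
  match ds with [::] => f | d :: ds' => pderiv d (pderivs ds' f) end.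

Definition smooth2 (f : R * R -> R) : Prop :=
  forall ds : seq 'I_2, continuous (pderivs ds f) /\
    (forall (i : 'I_2) (x : R * R), pderivable i (pderivs ds f) x).

Definition smooth1 (g : R -> R) : Prop :=
  forall n : nat, forall s : R, derivable (derive1n n g) s 1.

Definition test_fun (f : R * R -> R) : Prop :=
  smooth2 f /\ compact (closure [set x | f x != 0]) /\
  closure [set x | f x != 0] `<=` Bdisc.

Definition inLp (p : R) (f : R * R -> R) : Prop :=
  measurable_fun Bdisc f /\
  (\int[leb2]_(x in Bdisc) (`|f x| `^ p)%:E < +oo)%E.

Definition inLinfty (f : R * R -> R) : Prop :=
  measurable_fun Bdisc f /\
  exists M : R, {ae leb2, forall x, Bdisc x -> `|f x| <= M}.

Definition weak_gradient (u : R * R -> 'I_2 -> R)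
    (G : R * R -> 'I_2 -> 'I_2 -> R) : Prop :=
  forall (k i : 'I_2) (psi : R * R -> R), test_fun psi ->
    leb2.-integrable Bdisc (EFin \o (fun x => u x k * pderiv i psi x)) /\
    leb2.-integrable Bdisc (EFin \o (fun x => G x k i * psi x)) /\
    (\int[leb2]_(x in Bdisc) (u x k * pderiv i psi x)%:E =
     - \int[leb2]_(x in Bdisc) (G x k i * psi x)%:E)%E.

Definition Acoef (p : R) (u : 'I_2 -> R) (ka la i j : 'I_2) : R :=
  kdelta ka la * kdelta i j +
  (kdelta ka i + (2 * p / (2 - p)) * (u i * u ka / (1 + sqnorm2 u))) *
  (kdelta la j + (2 * p / (2 - p)) * (u j * u la / (1 + sqnorm2 u))).

Definition Aform (p : R) (u : 'I_2 -> R) (z zb : 'I_2 -> 'I_2 -> R) : R :=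
  \sum_(ka < 2) \sum_(la < 2) \sum_(i < 2) \sum_(j < 2)
    Acoef p u ka la i j * z ka i * zb la j.

Definition Aapply (p : R) (u : 'I_2 -> R) (z : 'I_2 -> 'I_2 -> R)
    (la j : 'I_2) : R :=
  \sum_(ka < 2) \sum_(i < 2) Acoef p u ka la i j * z ka i.

Definition mg (p : R) (g : R -> R) : R :=
  (p - 1)^-1 * (1 + sup (range (fun s => `|derive1 g s| + 2 * `|derive1n 2 g s| * s))).

Definition avec (p : R) (g : R -> R) (u : 'I_2 -> R) (z : 'I_2 -> 'I_2 -> R)
    (la j : 'I_2) : R :=
  (g (sqnormM z) + mg p g * Aform p u z z) `^ ((p - 2) / 2) * Aapply p u z la j.

(** u(x) = x / |x| (with the convention 0/0 = 0 at the single point x = 0) *)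
Definition uhedge (x : R * R) (k : 'I_2) : R :=
  coord2 x k / Num.sqrt (x.1 ^+ 2 + x.2 ^+ 2).

End Defs.

(* Main.v *)
Require Import Defs.
From HB Require Import structures.
From mathcomp Require Import all_boot all_order all_algebra.
From mathcomp Require Import all_classical all_reals all_analysis.
From mathcomp Require Import measurable_realfun ring lra.
Set Implicit Arguments.
Unset Strict Implicit.
Import Order.TTheory GRing.Theory Num.Theory.
Import numFieldNormedType.Exports.
Local Open Scope classical_set_scope.
Local Open Scope ring_scope.

(* On the disc |Du|^2 = 1/r^2 > 1, so g(|Du|^2) = 0, and with c = p/(2-p) and
   u = x/r the stress is a(u, Du) = K r^(1-p) (2 I + (c - 1) u u^T); its
   divergence off the origin is K r^(-p) (2 (1 - p) + (c - 1) (2 - p)) u = 0.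
   A single point has codimension 2, so no cut-off is needed to pass to the weak
   formulation: u and the stress are smooth on every horizontal or vertical line
   missing the origin, where one integrates by parts in one variable; Fubini
   then applies because all integrands are O(r^(-p)) with p < 2, and
   r^(-p) <= |x1|^(-p/2) |x2|^(-p/2) is integrable on the disc. *)

(** * Open sets of the plane and the product sigma-algebra *)

Lemma nbhs_rat_itv (R : realType) (x : R) (U : set R) : nbhs x U ->
  exists a b : rat, `]ratr a, ratr b[%classic x /\ `]ratr a, ratr b[%classic `<=` U.
Proof.
move=> /nbhs_ballP[e /= e0 xU].
have [a] := @rat_in_itvoo R (x - e) x ltac:(lra).
have [b] := @rat_in_itvoo R x (x + e) ltac:(lra).
rewrite !in_itv/= => /andP[xb be] /andP[ea ax].
exists a, b; split; first by rewrite /= in_itv/= ax xb.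
move=> y /=; rewrite in_itv/= => /andP[ay yb]; apply: xU.
by rewrite /ball/= ltr_norml; apply/andP; split; lra.
Qed.

(** Rational boxes form a countable base of the plane, so an open set is the countable union of
    those it contains, each a measurable rectangle. *)
Lemma open_measurable_prod (R : realType) (A : set (R * R)) :
  open A -> measurable A.
Proof.
pose box (q : rat * rat * (rat * rat)) : set (R * R) :=
  (`]ratr q.1.1, ratr q.1.2[%classic `*` `]ratr q.2.1, ratr q.2.2[%classic).
move=> oA.
have -> : A = \bigcup_q (if `[< box q `<=` A >] then box q else set0).
  apply/seteqP; split => [x Ax|x [q _]]; last by case: asboolP => // + qx; exact.
  have [[U V] /= [xU xV] UVA] : nbhs x A by exact: open_nbhs_nbhs.
  have [a [b [xab abU]]] := nbhs_rat_itv xU.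
  have [c [d [xcd cdV]]] := nbhs_rat_itv xV.
  exists ((a, b), (c, d)) => //; case: asboolP => // -[].
  by move=> y [y1 y2]; apply: UVA; split; [exact: abU|exact: cdV].
apply: countable_bigcupT_measurable => [|q]; first exact: countableP.
by case: ifP => _ //; apply: measurableX; exact: measurable_itv.
Qed.

Lemma continuous_measurable_fun_prod (R : realType) (f : R * R -> R) :
  continuous f -> measurable_fun setT f.
Proof.
move=> /continuousP cf; apply: (measurability _ (RGenOpens.measurableE R)).
move=> _ [_ [a [b ->] <-]]; rewrite setTI; apply: open_measurable_prod.
exact/cf/interval_open.
Qed.

(** * Calculus in one variable *)

Lemma is_derive_continuous (R : realType) (f g : R -> R) :
  (forall t : R, is_derive t 1 f (g t)) -> continuous f.
Proof.
move=> fg t; apply: differentiable_continuous; apply/derivable1_diffP.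
by have [] := fg t.
Qed.

(** The integrand is the derivative of [f * h], which vanishes at -1 and 1. On a line, [h] and [k]
    will be a test function and its derivative. *)
Lemma integral_derive_compact_support (R : realType) (f g h k : R -> R) :
  (forall t : R, is_derive t 1 f (g t)) -> continuous g ->
  (forall t : R, is_derive t 1 h (k t)) -> continuous k ->
  (forall t, 1 <= `|t| -> h t = 0 /\ k t = 0) ->
  (\int[lebesgue_measure]_t (f t * k t + g t * h t)%:E = 0)%E.
Proof.
move=> fg cg hk ck hk0.
have cf := is_derive_continuous fg; have ch := is_derive_continuous hk.
transitivity (\int[lebesgue_measure]_(t in `[(-1)%R, 1%R]) (f t * k t + g t * h t)%:E)%E.
  rewrite [RHS]integral_mkcond; apply: eq_integral => t _.
  rewrite patchE; case: ifPn => // /negP t1.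
  have [|-> ->] := hk0 t; last by rewrite !mulr0 addr0.
  rewrite leNgt; apply/negP => t1'; apply: t1; rewrite inE/= in_itv/=.
  by move: t1'; rewrite ltr_norml => /andP[? ?]; apply/andP; split; lra.
have fhD (t : R) : is_derive t 1 (f * h) (f t * k t + g t * h t).
  have H1 := fg t; have H2 := hk t.
  apply: is_derive_eq => /=. by rewrite /GRing.scale/= [h t * _]mulrC.
rewrite (@continuous_FTC2 _ _ (f * h)).
- have [|h1 _] := hk0 1; first by rewrite normr1.
  have [|hN1 _] := hk0 (-1); first by rewrite normrN normr1.
  by rewrite !fctE h1 hN1 !mulr0 sube0.
- by lra.
- apply: continuous_subspaceT => t.
  by apply: cvgD; apply: cvgM; [exact: cf|exact: ck|exact: cg|exact: ch].
- split.
  + by move=> t _; have [] := fhD t.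
  + by apply: cvg_at_right_filter; exact: (is_derive_continuous fhD).
  + by apply: cvg_at_left_filter; exact: (is_derive_continuous fhD).
- by move=> t _; rewrite derive1E; have [] := fhD t.
Qed.

Lemma is_derive_powR_sqrD (R : realType) (a e t : R) : 0 < t ^+ 2 + e ->
  is_derive t 1 (fun t => (t ^+ 2 + e) `^ a)
    (a * (t ^+ 2 + e) `^ (a - 1) * (2 * t)).
Proof.
move=> te; have H1 := is_derive1_powR a te.
have H2 : is_derive t 1 (fun t : R => t ^+ 2 + e) (2 * t).
  by apply: is_derive_eq; rewrite /GRing.scale/=; ring.
exact: (@is_derive1_comp R (@powR R ^~ a) (fun t => t ^+ 2 + e) t _ _ H1 H2).
Qed.

Lemma continuous_powR_sqrD (R : realType) (a e : R) : 0 < e ->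
  continuous (fun t : R => (t ^+ 2 + e) `^ a).
Proof.
move=> e0 t; apply: differentiable_continuous; apply/derivable1_diffP.
have te : 0 < t ^+ 2 + e by rewrite ltr_wpDl ?sqr_ge0.
by have [] := is_derive_powR_sqrD a te.
Qed.

(** The regularization [e] keeps the integrand smooth for the fundamental theorem of calculus; the
    bound is free of [e] and so survives the limit [e -> 0]. *)
Lemma integral_powR_sqrD_le (R : realType) (s e : R) : 0 < s < 1 -> 0 < e ->
  (\int[lebesgue_measure]_(t in `[(-1)%R, 1%R]) ((t ^+ 2 + e) `^ (- s / 2))%:E
   <= (2 / (1 - s))%:E)%E.
Proof.
move=> /andP[s0 s1] e0; set a := - s / 2.
have te (t : R) : 0 < t ^+ 2 + e by rewrite ltr_wpDl ?sqr_ge0.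
(* [F' >= (1 - s) (t^2 + e)^a] because [t^2 <= t^2 + e] and [2 a = - s]. *)
pose F (t : R) := t * (t ^+ 2 + e) `^ a.
pose f (t : R) := (t ^+ 2 + e) `^ a + t * (a * (t ^+ 2 + e) `^ (a - 1) * (2 * t)).
have dF (t : R) : is_derive t 1 F (f t).
  have H := is_derive_powR_sqrD a (te t).
  apply: (is_derive_eq (is_deriveM (is_derive_id t 1) H)).
  by rewrite /f /GRing.scale/= mulr1 addrC.
have cpow b : continuous (fun t : R => (t ^+ 2 + e) `^ b).
  exact: continuous_powR_sqrD.
have cid : continuous (fun t : R => t) by move=> t; exact: cvg_id.
have cf : continuous f.
  move=> t; apply: cvgD; first exact: cpow.
  apply: cvgM; first exact: cid.
  apply: cvgM; last by apply: cvgM; [exact: cvg_cst|exact: cid].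
  by apply: cvgM; [exact: cvg_cst|exact: cpow].
have f_ge (t : R) : (t ^+ 2 + e) `^ a <= (1 - s)^-1 * f t.
  rewrite -ler_pdivrMl ?invr_gt0 ?subr_gt0// invrK /f.
  have -> : (t ^+ 2 + e) `^ a = (t ^+ 2 + e) * (t ^+ 2 + e) `^ (a - 1).
    rewrite -[X in _ = X * _]powRr1 ?(ltW (te t))// -powRD ?(gt_eqF (te t)) ?implybT//.
    by rewrite subrKC.
  have := powR_ge0 (t ^+ 2 + e) (a - 1); set b := powR _ _ => b0.
  have -> : a = - s / 2 by [].
  rewrite -subr_ge0.
  have -> : (t ^+ 2 + e) * b + t * (- s / 2 * b * (2 * t)) -
    (1 - s) * ((t ^+ 2 + e) * b) = s * e * b by lra.
  by rewrite !mulr_ge0 // ltW.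
have mcont (h : R -> R) : continuous h ->
    measurable_fun (`[-1, 1]%classic : set R) (fun t => (h t)%:E).
  move=> ch; apply/measurable_EFinP; apply: measurable_funTS.
  exact: continuous_measurable_fun.
have f0 (t : R) : 0 <= f t.
  have := le_trans (powR_ge0 _ _) (f_ge t).
  by rewrite pmulr_rge0 // invr_gt0 subr_gt0.
apply: (@le_trans _ _
  (\int[lebesgue_measure]_(t in `[(-1)%R, 1%R]) ((1 - s)^-1%:E * (f t)%:E)))%E.
  apply: ge0_le_integral => //.
  - by move=> t _; rewrite lee_fin powR_ge0.
  - exact: mcont.
  - apply: (mcont (fun t => (1 - s)^-1 * f t)) => t.
    by apply: cvgM; [exact: cvg_cst|exact: cf].
  - by move=> t _; rewrite -EFinM lee_fin.
rewrite ge0_integralZl_EFin//; last 3 first.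
- by move=> t _; rewrite lee_fin.
- exact: mcont.
- by rewrite invr_ge0; lra.
rewrite (@continuous_FTC2 _ _ F); last first.
- by move=> t _; rewrite derive1E; have [] := dF t.
- have cF : continuous F.
    by move=> t; apply: cvgM; [exact: cid|exact: cpow].
  split; first by move=> t _; have [] := dF t.
  + by apply: cvg_at_right_filter; exact: cF.
  + by apply: cvg_at_left_filter; exact: cF.
- exact: continuous_subspaceT.
- lra.
rewrite /F sqrrN expr1n -EFinB -EFinM lee_fin mulrC ler_pM2r ?invr_gt0 ?subr_gt0//.
(* [F 1 - F (-1)] equals 2 (1 + e)^a, and the exponent [a] is negative. *)
suff : (1 + e) `^ a <= 1 by lra.
by rewrite -[leRHS](powRr0 (1 + e)); apply: ler_powR; rewrite /a; lra.
Qed.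

(** * Integrability of |x|^(-2s) on the disc for 0 < s < 1 *)

Definition nsq (R : realType) (x : R * R) : R := x.1 ^+ 2 + x.2 ^+ 2.

Lemma nsq_ge0 (R : realType) (x : R * R) : 0 <= nsq x.
Proof. by rewrite addr_ge0 ?sqr_ge0. Qed.

Lemma measurable_nsq (R : realType) : measurable_fun setT (@nsq R).
Proof. by apply: measurable_funD; apply: measurable_funX. Qed.

Lemma measurable_Bdisc (R : realType) : measurable (@Bdisc R).
Proof.
have -> : @Bdisc R = setT `&` @nsq R @^-1` `]-oo, 1[.
  by rewrite setTI; apply/seteqP; split => x /=; rewrite in_itv.
by apply: measurable_nsq => //; exact: measurable_itv.
Qed.

Section singular_integral.
Context {R : realType}.
Local Notation mu := (@lebesgue_measure R).
Local Notation mu2 := (@lebesgue_measure R \x @lebesgue_measure R)%E.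

(** The shift [2 * e] gives [e] to each coordinate; Tonelli then yields a product of two
    one-variable integrals. Uniformity in [e] prepares the use of Fatou's lemma. *)
Lemma integral_Bdisc_powR_nsqD_le (s e : R) : 0 < s < 1 -> 0 < e ->
  (\int[mu2]_(x in @Bdisc R) ((nsq x + 2 * e) `^ (- s))%:E
   <= ((2 / (1 - s)) ^+ 2)%:E)%E.
Proof.
move=> s01 e0; have /andP[s0 s1] := s01.
pose h : R -> R := (fun t => (t ^+ 2 + e) `^ (- s / 2)) \_ `[-1, 1].
have te (t : R) : 0 < t ^+ 2 + e by rewrite ltr_wpDl ?sqr_ge0.
have h0 t : 0 <= h t by rewrite /h patchE; case: ifP => // _; exact: powR_ge0.
have mh : measurable_fun setT h.
  apply/(measurable_restrictT _ _).1 => //; apply: measurable_funTS.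
  by apply: continuous_measurable_fun; exact: continuous_powR_sqrD.
have meh : measurable_fun setT (EFin \o h) by exact/measurable_EFinP.
have hle : (\int[mu]_t (h t)%:E <= (2 / (1 - s))%:E)%E.
  apply: le_trans (integral_powR_sqrD_le s01 e0).
  rewrite [leRHS]integral_mkcond le_eqVlt; apply/orP; left; apply/eqP.
  by apply: eq_integral => t _; rewrite /h !patchE; case: ifP.
have mB := @measurable_Bdisc R.
have msh : measurable_fun setT (fun x : R * R => (nsq x + 2 * e) `^ (- s)).
  apply: (@measurableT_comp _ _ _ _ _ _ (fun r : R => r `^ (- s))) => //.
  by apply: measurable_funD => //; exact: measurable_nsq.
have mhh : measurable_fun setT (fun x : R * R => h x.1 * h x.2).
  by apply: measurable_funM; apply: measurableT_comp.
apply: (@le_trans _ _ (\int[mu2]_x (h x.1 * h x.2)%:E)%E).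
  rewrite integral_mkcond; apply: ge0_le_integral => //.
  - by move=> x _; rewrite patchE; case: ifP => // _; rewrite lee_fin powR_ge0.
  - apply/(measurable_restrictT _ _).1 => //; apply/measurable_EFinP.
    exact: measurable_funTS.
  - exact/measurable_EFinP.
  - move=> x _; rewrite patchE; case: ifPn => [|_]; last by rewrite lee_fin mulr_ge0.
    rewrite inE/= => xB; rewrite lee_fin /h !patchE.
    have itv (t : R) : t ^+ 2 <= 1 -> t \in `[(-1)%R, 1%R]%classic.
      move=> t1; rewrite inE/= in_itv/= -ler_norml -(@ler_pXn2r _ 2) ?nnegrE//.
      by rewrite real_normK ?num_real// expr1n.
    have x1 : x.1 ^+ 2 <= 1 by have := sqr_ge0 x.2; rewrite /Bdisc/= in xB; lra.
    have x2 : x.2 ^+ 2 <= 1 by have := sqr_ge0 x.1; rewrite /Bdisc/= in xB; lra.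
    rewrite !itv// -powRM ?(ltW (te _))//.
    (* [(A + B)^2 >= A B] splits the radial singularity into one-variable ones. *)
    set A := _ + e; set B := _ + e.
    have A0 : 0 < A := te _; have B0 : 0 < B := te _.
    have -> : nsq x + 2 * e = A + B by rewrite /nsq /A /B; ring.
    have -> : - s / 2 = - (s / 2) by rewrite mulNr.
    have -> : - s = 2 * - (s / 2) by field.
    have ABp : 0 < A + B by exact: addr_gt0.
    have AB0 : 0 <= A + B by exact: ltW.
    have AB : 0 < A * B by exact: mulr_gt0.
    rewrite powRrM [(A + B) `^ 2](powR_mulrn 2 AB0) !powRN.
    rewrite lef_pV2 ?posrE; try by apply: powR_gt0 => //; exact: exprn_gt0.
    apply: ge0_ler_powR; rewrite ?nnegrE; [lra|exact: ltW|exact: sqr_ge0|nra].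
have -> : (\int[mu2]_x (h x.1 * h x.2)%:E = \int[mu]_x \int[mu]_y (h x * h y)%:E)%E.
  have := @fubini_tonelli1 _ _ _ _ _ mu mu (fun x => (h x.1 * h x.2)%:E).
  apply; first exact/measurable_EFinP.
  by move=> x; rewrite lee_fin mulr_ge0.
have hpos : (0 <= \int[mu]_t (h t)%:E)%E by apply: integral_ge0 => t _; rewrite lee_fin.
have hfin : (\int[mu]_t (h t)%:E)%E \is a fin_num.
  by rewrite ge0_fin_numE// (le_lt_trans hle)// ltry.
under eq_integral => t _.
  under eq_integral do rewrite EFinM.
  rewrite ge0_integralZl_EFin//; last by move=> u _; rewrite lee_fin.
  rewrite -(fineK hfin) muleC.
  over.
rewrite ge0_integralZl_EFin//; last 2 first.
- by move=> u _; rewrite lee_fin.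
- by rewrite fine_ge0.
rewrite fineK// expr2 EFinM; exact: lee_pmul.
Qed.

Lemma measurable_powR_nsq (a : R) : measurable_fun setT (fun x : R * R => nsq x `^ a).
Proof.
apply: (@measurableT_comp _ _ _ _ _ _ (fun r : R => r `^ a)) => //.
exact: measurable_nsq.
Qed.

(** Fatou's lemma along the regularizations with [e] equal to [harmonic n], whose integrals have a
    common bound. *)
Lemma integrable_powR_nsq (s : R) : 0 < s < 1 ->
  mu2.-integrable (@Bdisc R) (fun x => (nsq x `^ (- s))%:E).
Proof.
move=> s01; have /andP[s0 s1] := s01.
have mB := @measurable_Bdisc R.
have mf := measurable_powR_nsq (- s).
have mef D : measurable D -> measurable_fun D (fun x : R * R => (nsq x `^ (- s))%:E).
  by move=> mD; apply/measurable_EFinP; exact: measurable_funTS.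
apply/integrableP; split; first exact: mef.
under eq_integral do rewrite gee0_abs ?lee_fin ?powR_ge0//.
(* At the origin the regularized powers tend to infinity while [powR] gives 0, so convergence is
   claimed only on [D]. Removing the point keeps the integral, since the integrand is 0 there. *)
pose D : set (R * R) := @Bdisc R `&` [set x | 0 < nsq x].
have mD : measurable D.
  apply: measurableI => //; rewrite -[X in measurable X]setTI.
  have -> : [set x : R * R | 0 < nsq x] = @nsq R @^-1` `]0, +oo[.
    by apply/seteqP; split => x /=; rewrite in_itv/= andbT.
  by apply: measurable_nsq => //; exact: measurable_itv.
pose f n (x : R * R) := ((nsq x + 2 * harmonic n) `^ (- s))%:E.
have f0 n x : (0 <= f n x)%E by rewrite lee_fin powR_ge0.
have mfn n A : measurable A -> measurable_fun A (f n).
  move=> mA; apply/measurable_EFinP; apply: measurable_funTS.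
  apply: (@measurableT_comp _ _ _ _ _ _ (fun r : R => r `^ (- s))) => //.
  by apply: measurable_funD => //; exact: measurable_nsq.
have fcvg x : D x -> (f n x @[n --> \oo] --> (nsq x `^ (- s))%:E)%E.
  move=> [_ /= x0]; apply: cvg_EFin; first by apply: nearW.
  apply: (@continuous_cvg _ _ _ _ _ _ (fun r : R => r `^ (- s))).
    apply: differentiable_continuous; apply/derivable1_diffP.
    by have [] := is_derive1_powR (- s) x0.
  rewrite -[X in _ --> X]addr0; apply: cvgD; first exact: cvg_cst.
  rewrite -(mulr0 2); apply: cvgM; first exact: cvg_cst.
  exact: cvg_harmonic.
have -> : (\int[mu2]_(x in @Bdisc R) (nsq x `^ (- s))%:E =
           \int[mu2]_(x in D) limn_einf (f ^~ x))%E.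
  rewrite integral_mkcond [RHS]integral_mkcond; apply: eq_integral => x _.
  rewrite !patchE; case: ifPn => xB.
    case: ifPn => xD; first by rewrite (cvg_limn_einf_sup (fcvg x (set_mem xD))).
    move: (nsq_ge0 x); rewrite le_eqVlt => /predU1P[<-|x0].
      by rewrite powR0// oppr_eq0 gt_eqF.
    by move: xD; rewrite notin_setE => -[]; split => //; exact: set_mem.
  case: ifPn => // xD.
  by move: xB; rewrite notin_setE => -[]; have [] := set_mem xD.
apply: (@le_lt_trans _ _ ((2 / (1 - s)) ^+ 2)%:E); last exact: ltry.
have := @fatou _ _ R mu2 D mD f (fun n => mfn n D mD) (fun n x _ => f0 n x).
move=> /le_trans; apply.
rewrite limn_einf_lim; apply: lime_le; first exact: is_cvg_einfs.
apply: nearW => n; apply: (@le_trans _ _ (\int[mu2]_(x in D) f n x)%E).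
  by apply: ereal_inf_lbound; exists n => /=.
apply: (le_trans _ (integral_Bdisc_powR_nsqD_le s01 (harmonic_gt0 n))) => //.
by apply: ge0_subset_integral => //; [exact: mfn|move=> x []].
Qed.
End singular_integral.

(** * Coordinate lines and test functions *)

Definition line (R : realType) (i : 'I_2) (t y : R) : R * R :=
  if i == ord0 then (t, y) else (y, t).

Lemma continuous_line (R : realType) (i : 'I_2) (y : R) :
  continuous (fun t => line i t y).
Proof.
move=> t; rewrite /line; case: (i == ord0).
  exact: (@cvg_pair _ _ _ _ (nbhs t) (nbhs y) _ _ _ id (cst y) cvg_id (cvg_cst y)).
exact: (@cvg_pair _ _ _ _ (nbhs y) (nbhs t) _ _ _ (cst y) id (cvg_cst y) cvg_id).
Qed.

Section test_functions.
Context {R : realType}.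
Variable psi : R * R -> R.
Hypothesis tpsi : test_fun psi.

Let K := closure [set x | psi x != 0].

Lemma test_fun_continuous : continuous psi.
Proof. by have [/(_ [::])[]] := tpsi. Qed.

Lemma test_fun_pderiv_continuous i : continuous (pderiv i psi).
Proof. by have [/(_ [:: i])[]] := tpsi. Qed.

Lemma test_fun_is_derive i y (t : R) :
  is_derive t 1 (fun t => psi (line i t y)) (pderiv i psi (line i t y)).
Proof.
have [/(_ [::])[_ /(_ i (line i t y))] /= + _] := tpsi.
rewrite /pderivable /pderiv /line; case: (i == ord0) => /= d.
  by rewrite derive1E; exact: DeriveDef.
by rewrite derive1E; exact: DeriveDef.
Qed.

Lemma test_fun_eq0 x : ~ K x -> psi x = 0.
Proof.
by move=> Kx; apply/eqP/negPn/negP => x0; apply: Kx; exact: subset_closure.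
Qed.

(** The complement of the closed support is open, so along the line through [x] the function is 0
    near [x]. *)
Lemma test_fun_pderiv_eq0 i x : ~ K x -> pderiv i psi x = 0.
Proof.
move=> Kx; have [[a b] xab] : exists ty : R * R, x = line i ty.1 ty.2.
  case: x {Kx} => x y; rewrite /line; case: (i == ord0).
    by exists (x, y).
  by exists (y, x).
rewrite xab/= in Kx *.
have Kab : \forall t \near a, ~ K (line i t b).
  have oK : nbhs (line i a b) (~` K).
    apply: open_nbhs_nbhs; split => //.
    by apply: closed_openC; exact: closed_closure.
  exact: (@continuous_line R i b a _ oK).
have [_ <-] := test_fun_is_derive i b a.
have /near_eq_derive -> : \forall t \near a, psi (line i t b) = cst 0 t.
  by near=> t; apply: test_fun_eq0; near: t.
by rewrite derive_cst.
Unshelve. all: by end_near. Qed.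

Lemma test_fun_bounded (h : R * R -> R) : continuous h ->
  (forall x, ~ K x -> h x = 0) -> exists M, forall x, `|h x| <= M.
Proof.
move=> ch h0; have [_ [cK _]] := tpsi.
have /compact_bounded[M [_ HM]] : compact (h @` K).
  by apply: continuous_compact => //; exact: continuous_subspaceT.
exists (`|M| + 1) => x; have [Kx|Kx] := pselect (K x).
  apply: (HM (`|M| + 1)); last by exists x.
  by rewrite (le_lt_trans (ler_norm _))// ltrDl.
by rewrite h0// normr0 addr_ge0.
Qed.

Lemma test_fun_sub x : K x -> Bdisc x.
Proof. by have [_ [_]] := tpsi; exact. Qed.

End test_functions.

(** * Integration by parts for fields singular at the origin *)

(** The bound is of order |x|^(-2s). For [s != 0] it is 0 at the origin by the convention of [powR],
    so domination then forces [f] to vanish there. *)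
Definition dominated (R : realType) (s : R) (f : R * R -> R) :=
  measurable_fun setT f /\
  exists C : R, forall x, Bdisc x -> `|f x| <= C * nsq x `^ (- s).

Section integration_by_parts.
Context {R : realType}.
Local Notation mu := (@lebesgue_measure R).
Local Notation mu2 := (@lebesgue_measure R \x @lebesgue_measure R)%E.
Variable s : R.
Hypothesis s01 : 0 < s < 1.

Lemma dominated_integrable (f : R * R -> R) : dominated s f ->
  mu2.-integrable (@Bdisc R) (EFin \o f).
Proof.
move=> [mf [C fC]].
have mB := @measurable_Bdisc R.
have := @le_integrable _ _ R mu2 (@Bdisc R) mB (EFin \o f)
  (fun x => (C * nsq x `^ (- s))%:E).
apply.
- by apply/measurable_EFinP; exact: measurable_funTS.
- by move=> x xB /=; rewrite lee_fin (le_trans (fC _ xB))// ler_norm.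
- under eq_fun do rewrite EFinM.
  by apply: integrableZl => //; exact: integrable_powR_nsq.
Qed.

Lemma dominatedM (f h : R * R -> R) (M : R) : dominated s f ->
  measurable_fun setT h -> (forall x, `|h x| <= M) ->
  dominated s (fun x => f x * h x).
Proof.
move=> [mf [C fC]] mh hM; split; first exact: measurable_funM.
exists (C * M) => x xB; rewrite normrM mulrAC.
by apply: ler_pM => //; exact: fC.
Qed.

Lemma dominatedD (f h : R * R -> R) : dominated s f -> dominated s h ->
  dominated s (fun x => f x + h x).
Proof.
move=> [mf [C fC]] [mh [D hD]]; split; first exact: measurable_funD.
exists (C + D) => x xB; rewrite mulrDl (le_trans (ler_normD _ _))// lerD//.
  exact: fC.
exact: hD.
Qed.

Lemma dominatedZ (f : R * R -> R) c : dominated s f ->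
  dominated s (fun x => c * f x).
Proof.
move=> [mf [C fC]]; split; first exact: measurable_funM.
by exists (`|c| * C) => x xB; rewrite normrM -mulrA ler_wpM2l// fC.
Qed.

(** Fubini with [t] as the inner variable. The line through the origin corresponds to the single
    value [y = 0], a null set for the outer integral. *)
Lemma integral_line (i : 'I_2) (f : R * R -> R) :
  mu2.-integrable setT (EFin \o f) ->
  (forall y, y != 0 -> (\int[mu]_t (f (line i t y))%:E = 0)%E) ->
  (\int[mu2]_x (f x)%:E = 0)%E.
Proof.
move=> intf f0.
have ae0 (g : R -> \bar R) : (forall y, y != 0 -> g y = 0%E) ->
    measurable_fun setT g -> (\int[mu]_y g y = 0)%E.
  move=> g0 mg; rewrite -(integral0 mu setT); apply: ae_eq_integral => //.
  exists [set 0]; split => //; first exact: lebesgue_measure_set1.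
  move=> y /= gy; apply: contrapT => /eqP y0; apply: gy => _; exact: g0.
move: f0; rewrite /line; case: (i == ord0) => f0.
  have <- := integral21_prod_meas1 intf; apply: ae0 => //.
  exact: (measurable_fubini_G intf).
have <- := integral12_prod_meas1 intf; apply: ae0 => //.
exact: (measurable_fubini_F intf).
Qed.

(** On each line avoiding the origin the derivative of [f * psi] integrates to 0, and Fubini
    collects the lines. Domination supplies the integrability that Fubini asks for. *)
Lemma dominated_integration_by_parts (i : 'I_2) (f g psi : R * R -> R) :
  dominated s f -> dominated s g ->
  (forall y, y != 0 ->
     (forall t : R, is_derive t 1 (fun t => f (line i t y)) (g (line i t y))) /\
     continuous (fun t => g (line i t y))) ->
  test_fun psi ->
  [/\ mu2.-integrable (@Bdisc R) (EFin \o (fun x => f x * pderiv i psi x)),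
      mu2.-integrable (@Bdisc R) (EFin \o (fun x => g x * psi x)) &
      (\int[mu2]_(x in @Bdisc R) (f x * pderiv i psi x)%:E =
       - \int[mu2]_(x in @Bdisc R) (g x * psi x)%:E)%E].
Proof.
move=> df dg fg tpsi.
have cpsi := test_fun_continuous tpsi.
have cdpsi := @test_fun_pderiv_continuous R psi tpsi i.
have [M psiM] := test_fun_bounded tpsi cpsi (test_fun_eq0 (psi := psi)).
have [N psiN] := test_fun_bounded tpsi cdpsi (@test_fun_pderiv_eq0 R psi tpsi i).
have mpsi := continuous_measurable_fun_prod cpsi.
have mdpsi := continuous_measurable_fun_prod cdpsi.
have i1 := dominated_integrable (dominatedM df mdpsi psiN).
have i2 := dominated_integrable (dominatedM dg mpsi psiM).
split => //.
have mB := @measurable_Bdisc R.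
have psi0 x : ~ Bdisc x -> psi x = 0 /\ pderiv i psi x = 0.
  move=> xB; have Kx : ~ closure [set x | psi x != 0] x.
    by move=> /(test_fun_sub tpsi).
  by split; [exact: test_fun_eq0 Kx|exact: test_fun_pderiv_eq0 Kx].
(* [psi] and its derivative vanish off the disc, so the integrand is its own restriction and the
   integral may be taken over the plane. *)
have restr : (EFin \o (fun x => f x * pderiv i psi x + g x * psi x)) \_ (@Bdisc R) =
    EFin \o (fun x => f x * pderiv i psi x + g x * psi x).
  apply/funext => x; rewrite patchE; case: ifPn => //.
  rewrite notin_setE => /psi0 [/= -> ->].
  by rewrite !mulr0 addr0.
have AB0 : (\int[mu2]_(x in @Bdisc R) (f x * pderiv i psi x)%:E +
            \int[mu2]_(x in @Bdisc R) (g x * psi x)%:E = 0)%E.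
  rewrite -integralD//.
  rewrite [LHS](_ : _ =
    \int[mu2]_x (f x * pderiv i psi x + g x * psi x)%:E)%E; last first.
    rewrite integral_mkcond; apply: eq_integral => x _.
    exact: (congr1 (fun h => h x) restr).
  apply: (integral_line (i := i)).
    rewrite -restr; apply: (proj1 (@integrable_mkcond _ _ R mu2 _ _ mB)).
    exact: (@integrableD _ _ R mu2 _ mB _ _ i1 i2).
  move=> y y0; have [fgy cg] := fg y y0.
  apply: integral_derive_compact_support => //.
  - exact: test_fun_is_derive.
  - move=> t; apply: (@continuous_comp _ _ _ (fun t => line i t y) (pderiv i psi)).
      exact: continuous_line.
    exact: cdpsi.
  (* For |t| >= 1 the point on the line lies outside the open disc, whatever [y] is. *)
  - move=> t t1; apply: psi0 => /=; apply/negP; rewrite -leNgt.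
    have : 1 <= t ^+ 2 by rewrite -[t ^+ 2]real_normK ?num_real// expr_ge1.
    rewrite /line; case: (i == ord0) => /=; have := sqr_ge0 y; lra.
(* Finiteness of the second integral permits cancellation in the extended reals. *)
have fin := @integrable_fin_num _ _ R mu2 _ mB _ i2.
by rewrite -[LHS](addeK _ fin) AB0 add0e.
Qed.
End integration_by_parts.

(** * Derivatives of coordinates and radial powers along lines *)

Section lines.
Context {R : realType}.
Implicit Types (i k : 'I_2) (y t a : R).

Lemma is_derive_coord2_line i k y t :
  is_derive t 1 (fun t => coord2 (line i t y) k) (kdelta R k i).
Proof.
have id1 : is_derive t 1 (fun t : R => t) 1 := is_derive_id t 1.
have cst0 : is_derive t 1 (fun _ : R => y) 0 := is_derive_cst y t 1.
by case: k i => [[|[|k]] ?] [[|[|i]] ?].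
Qed.

Lemma is_derive_powR_nsq_line i y t a : y != 0 ->
  is_derive t 1 (fun t => nsq (line i t y) `^ a)
    (2 * a * coord2 (line i t y) i * nsq (line i t y) `^ (a - 1)).
Proof.
move=> y0; have nsqE u : nsq (line i u y) = u ^+ 2 + y ^+ 2.
  by rewrite /line /nsq; case: ifP => //= _; rewrite addrC.
have coordE : coord2 (line i t y) i = t by rewrite /line /coord2; case: (i == ord0).
under eq_fun do rewrite nsqE.
have ty : 0 < t ^+ 2 + y ^+ 2 by rewrite ltr_wpDl ?sqr_ge0// lt0r sqrf_eq0 y0 sqr_ge0.
rewrite nsqE coordE (_ : 2 * a * t * _ = a * (t ^+ 2 + y ^+ 2) `^ (a - 1) * (2 * t)).
  exact: is_derive_powR_sqrD.
ring.
Qed.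
End lines.

(** * Domination by counting degrees *)

Section monomials.
Context {R : realType}.

Lemma measurable_coord2 k : measurable_fun setT (fun x : R * R => coord2 x k).
Proof.
rewrite /coord2; case: (k == ord0); first exact: measurable_fst.
exact: measurable_snd.
Qed.

(* [0 < nsq x] because [0 `^ (d + e)] need not be [0 `^ d * 0 `^ e]. *)
Definition degree_ge (d : R) (P : R * R -> R) :=
  measurable_fun setT P /\ forall x, 0 < nsq x -> `|P x| <= nsq x `^ d.

Lemma degree_ge_cst1 : degree_ge 0 (cst 1).
Proof. by split => // x _; rewrite powRr0 normr1. Qed.

(** Degrees count powers of [nsq], hence half the homogeneity degree in |x|. *)
Lemma degree_ge_coord2 k : degree_ge 2^-1 (fun x => coord2 x k).
Proof.
split; first exact: measurable_coord2.
move=> x _; rewrite powR12_sqrt ?nsq_ge0// -sqrtr_sqr ler_sqrt ?nsq_ge0//.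
rewrite /coord2 /nsq; case: (k == ord0); first by rewrite lerDl sqr_ge0.
by rewrite lerDr sqr_ge0.
Qed.

Lemma degree_geM d e P Q : degree_ge d P -> degree_ge e Q ->
  degree_ge (d + e) (fun x => P x * Q x).
Proof.
move=> [mP Pd] [mQ Qe]; split; first exact: measurable_funM.
move=> x x0; rewrite normrM powRD ?(gt_eqF x0) ?implybT//.
by apply: ler_pM => //; [exact: Pd|exact: Qe].
Qed.

(** In the disc [nsq x <= 1], so lowering the exponent from [d + a] to [- s] can only increase the
    power. At the origin [a != 0] makes the function 0. *)
Lemma dominated_degree_ge d a s P : degree_ge d P -> a != 0 -> - s <= d + a ->
  dominated s (fun x => P x * nsq x `^ a).
Proof.
move=> [mP Pd] a0 sda; split.
  by apply: measurable_funM => //; exact: measurable_powR_nsq.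
exists 1 => x xB; rewrite mul1r.
have := nsq_ge0 x; rewrite le_eqVlt => /predU1P[x0|x0].
  by rewrite -x0 powR0// mulr0 normr0 powR_ge0.
rewrite normrM [X in _ * X]ger0_norm ?powR_ge0//.
apply: (@le_trans _ _ (nsq x `^ (d + a))).
  by rewrite powRD ?(gt_eqF x0) ?implybT// ler_wpM2r ?powR_ge0// Pd.
by apply: ger_powR => //; rewrite x0 ltW.
Qed.

(** Off the origin the hypothesis reads |f| <= C / |x|; the p-th power is then of order |x|^(-p),
    integrable because p/2 < 1. *)
Lemma dominated_inLp (p : R) f : 1 < p < 2 -> dominated 2^-1 f -> inLp p f.
Proof.
move=> /andP[p1 p2] [mf [C fC]].
have mB := @measurable_Bdisc R.
split; first exact: measurable_funTS.
have p02 : 0 < p / 2 < 1 by apply/andP; split; lra.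
have I := integrable_powR_nsq p02.
have mfp : measurable_fun setT (fun x => `|f x| `^ p).
  apply: (@measurableT_comp _ _ _ _ _ _ (fun r : R => r `^ p)) => //.
  exact: measurableT_comp.
have : (@leb2 R).-integrable (@Bdisc R) (EFin \o (fun x => `|f x| `^ p)).
  apply: (dominated_integrable p02); split => //.
  exists (`|C| `^ p) => x xB.
  have -> : - (p / 2) = (- 2^-1) * p by lra.
  rewrite ger0_norm ?powR_ge0// powRrM -powRM ?powR_ge0//.
  apply: ge0_ler_powR; rewrite ?nnegrE//.
  - by lra.
  - by rewrite mulr_ge0 ?powR_ge0.
  - by rewrite (le_trans (fC _ xB))// ler_wpM2r ?powR_ge0// ler_norm.
move=> /integrableP[_]; apply: le_lt_trans.
rewrite le_eqVlt; apply/orP; left; apply/eqP; apply: eq_integral => x _ /=.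
by rewrite (ger0_norm (powR_ge0 _ _)).
Qed.

End monomials.

Lemma ord2_ind (P : 'I_2 -> Prop) :
  P ord0 -> P (lift ord0 ord0) -> forall i, P i.
Proof.
move=> P0 P1 [[|[|i]] lti] //.
  by rewrite (_ : Ordinal lti = ord0)//; exact/val_inj.
by rewrite (_ : Ordinal lti = lift ord0 ord0)//; exact/val_inj.
Qed.

(** * The map x/|x|, its gradient and the stress as explicit fields *)

Section fields.
Context {R : realType}.
Implicit Types (a b A B p : R) (x : R * R) (i j k la : 'I_2).

(** The product rule for x_k |x|^(-1), left unsimplified. Off the origin it equals (delta_ki - u_k
    u_i) / |x| with u = x/|x|; at the origin it is 0. *)
Definition dhedge x k i : R :=
  kdelta R k i * nsq x `^ (- 2^-1) +
  coord2 x k * (2 * (- 2^-1) * coord2 x i * nsq x `^ (- 2^-1 - 1)).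

(** Off the origin, the entries of r^(2b) (A I + B u u^T) with r = |x| and u = x/r. Free
    coefficients keep the calculus apart from the algebra of the stress. *)
Definition flux A B b la j x : R :=
  A * kdelta R la j * nsq x `^ b +
  B * (coord2 x la * coord2 x j * nsq x `^ (b - 1)).

(** The derivative of the entry [la], [j] of [flux] in the direction [j] only, so that summing over
    [j] gives the divergence. *)
Definition dflux A B b la j x : R :=
  A * kdelta R la j * (2 * b * coord2 x j * nsq x `^ (b - 1)) +
  B * ((kdelta R la j * coord2 x j + coord2 x la) * nsq x `^ (b - 1) +
        coord2 x la * coord2 x j *
          (2 * (b - 1) * coord2 x j * nsq x `^ (b - 1 - 1))).

Lemma uhedgeE x k : uhedge x k = coord2 x k * nsq x `^ (- 2^-1).
Proof. by rewrite powRN powR12_sqrt ?nsq_ge0. Qed.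

(** In the sum the identity part contributes 2b A and the rank-one part (3 + 2(b - 1)) B, both times
    x_la r^(2b-2); the hypothesis makes the total coefficient vanish. *)
Lemma dflux_div A B b la x : 2 * b * A + (2 * b + 1) * B = 0 ->
  \sum_(j < 2) dflux A B b la j x = 0.
Proof.
move=> hAB; rewrite !big_ord_recl big_ord0 addr0.
have := nsq_ge0 x; rewrite le_eqVlt => /predU1P[|x0].
  (* At the origin every term contains a vanishing coordinate. *)
  move=> /esym/eqP; rewrite paddr_eq0 ?sqr_ge0// !sqrf_eq0 => /andP[/eqP x1 /eqP x2].
  rewrite /dflux /coord2 /= x1 x2 (if_same _ _).
  by rewrite !(mulr0, mul0r, addr0).
have E : nsq x `^ (b - 1) = nsq x * nsq x `^ (b - 1 - 1).
  rewrite -[X in _ = X * _]powRr1 ?nsq_ge0// -powRD ?(gt_eqF x0) ?implybT//.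
  by rewrite subrKC.
transitivity (coord2 x la * nsq x * nsq x `^ (b - 1 - 1) *
  (2 * b * A + (2 * b + 1) * B)); last by rewrite hAB mulr0.
rewrite /dflux E; move: (powR _ _) => P; rewrite /nsq.
elim/ord2_ind: la; rewrite /kdelta /coord2 /=; ring.
Qed.

Let continuous_coord2_line i y k : continuous (fun t : R => coord2 (line i t y) k).
Proof. exact: is_derive_continuous (fun t => is_derive_coord2_line i k y t). Qed.

Let continuous_nsq_line i y a : y != 0 ->
  continuous (fun t : R => nsq (line i t y) `^ a).
Proof.
move=> y0; exact: is_derive_continuous (fun t => is_derive_powR_nsq_line i t a y0).
Qed.

Lemma uhedge_is_derive_line k i y : y != 0 ->
  (forall t : R, is_derive t 1 (fun t => uhedge (line i t y) k)
                   (dhedge (line i t y) k i)) /\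
  continuous (fun t => dhedge (line i t y) k i).
Proof.
move=> y0; split => t.
  under eq_fun do rewrite uhedgeE.
  apply: (is_derive_eq (is_deriveM (is_derive_coord2_line i k y t)
                          (is_derive_powR_nsq_line i t (- 2^-1) y0))).
  by rewrite /dhedge /GRing.scale/=; ring.
apply: cvgD; apply: cvgM.
- exact: cvg_cst.
- exact: continuous_nsq_line.
- exact: continuous_coord2_line.
- apply: cvgM; last exact: continuous_nsq_line.
  by apply: cvgM; [exact: cvg_cst|exact: continuous_coord2_line].
Qed.

Lemma flux_is_derive_line A B b la j y : y != 0 ->
  (forall t : R, is_derive t 1 (fun t => flux A B b la j (line j t y))
                   (dflux A B b la j (line j t y))) /\
  continuous (fun t => dflux A B b la j (line j t y)).
Proof.
move=> y0.
have C k := continuous_coord2_line (i := j) (y := y) (k := k).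
have P a := continuous_nsq_line (i := j) (a := a) y0.
split => t.
  have D k := is_derive_coord2_line j k y t.
  have E a := is_derive_powR_nsq_line j t a y0.
  have H1 := is_deriveM (is_derive_cst (A * kdelta R la j) t 1) (E b).
  have H2 := is_deriveM (is_derive_cst B t 1)
    (is_deriveM (is_deriveM (D la) (D j)) (E (b - 1))).
  apply: (is_derive_eq (is_deriveD H1 H2)).
  have jj : kdelta R j j = 1 by rewrite /kdelta eqxx.
  by rewrite /dflux /GRing.scale/= jj !fctE; ring.
apply: cvgD; apply: cvgM; first exact: cvg_cst.
- apply: cvgM; last exact: P.
  by apply: cvgM; [exact: cvg_cst|exact: C].
- exact: cvg_cst.
- apply: cvgD; apply: cvgM.
  + apply: cvgD; last exact: C.
    by apply: cvgM; [exact: cvg_cst|exact: C].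
  + exact: P.
  + by apply: cvgM; exact: C.
  + apply: cvgM; last exact: P.
    by apply: cvgM; [exact: cvg_cst|exact: C].
Qed.

Lemma uhedge_dominated s k : 0 <= s -> dominated s (fun x => uhedge x k).
Proof.
move=> s0; under eq_fun do rewrite uhedgeE.
apply: (dominated_degree_ge (degree_ge_coord2 k)); lra.
Qed.

Lemma dhedge_dominated s k i : 2^-1 <= s -> dominated s (fun x => dhedge x k i).
Proof.
move=> s0; apply: dominatedD.
  apply: dominatedZ; under eq_fun do rewrite -[_ `^ _]mul1r.
  by apply: (dominated_degree_ge degree_ge_cst1); lra.
have -> : (fun x : R * R =>
    coord2 x k * (2 * - 2^-1 * coord2 x i * nsq x `^ (- 2^-1 - 1)))
  = (fun x => (2 * - 2^-1) * ((coord2 x k * coord2 x i) * nsq x `^ (- 2^-1 - 1))).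
  by apply/funext => x; ring.
apply: dominatedZ.
by apply: (dominated_degree_ge
  (degree_geM (degree_ge_coord2 k) (degree_ge_coord2 i))); lra.
Qed.

Lemma flux_dominated A B p la j : 1 < p < 2 ->
  dominated (p / 2) (flux A B ((1 - p) / 2) la j).
Proof.
move=> /andP[p1 p2]; apply: dominatedD.
  apply: dominatedZ; under eq_fun do rewrite -[_ `^ _]mul1r.
  by apply: (dominated_degree_ge degree_ge_cst1); lra.
apply: dominatedZ.
by apply: (dominated_degree_ge
  (degree_geM (degree_ge_coord2 la) (degree_ge_coord2 j))); lra.
Qed.

(** The terms have degree exactly -p/2, as 1/2 + (b - 1) or 3/2 + (b - 2). This field dictates the
    exponent [p / 2] in the integration by parts for the stress. *)
Lemma dflux_dominated A B p la j : 1 < p < 2 ->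
  dominated (p / 2) (dflux A B ((1 - p) / 2) la j).
Proof.
move=> /andP[p1 p2]; set b := (1 - p) / 2.
have b1 : b - 1 != 0 by rewrite /b; lra.
have b2 : b - 1 - 1 != 0 by rewrite /b; lra.
have H k : dominated (p / 2) (fun x => coord2 x k * nsq x `^ (b - 1)).
  by apply: (dominated_degree_ge (degree_ge_coord2 k)) => //; rewrite /b; lra.
have H3 : dominated (p / 2)
    (fun x => coord2 x la * coord2 x j * coord2 x j * nsq x `^ (b - 1 - 1)).
  apply: (dominated_degree_ge (degree_geM (degree_geM (degree_ge_coord2 la)
    (degree_ge_coord2 j)) (degree_ge_coord2 j))) => //; rewrite /b; lra.
have -> : dflux A B b la j = fun x =>
    (A * kdelta R la j * (2 * b) + B * kdelta R la j) * (coord2 x j * nsq x `^ (b - 1)) +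
    (B * (coord2 x la * nsq x `^ (b - 1)) +
     (B * (2 * (b - 1))) *
       (coord2 x la * coord2 x j * coord2 x j * nsq x `^ (b - 1 - 1))).
  by apply/funext => x; rewrite /dflux; ring.
by apply: dominatedD; [|apply: dominatedD]; apply: dominatedZ.
Qed.

End fields.

(** * Algebra of the coefficients and of the stress *)

Section stress.
Context {R : realType}.
Implicit Types (p : R) (u : 'I_2 -> R) (z : 'I_2 -> 'I_2 -> R) (x : R * R).

Let tr z := z ord0 ord0 + z (lift ord0 ord0) (lift ord0 ord0).
Let quad u z := \sum_(k < 2) \sum_(i < 2) u i * u k * z k i.
Let c p u := 2 * p / (2 - p) / (1 + sqnorm2 u).

(** With T = I + c u u^T, the tensor A(u) is the identity plus the tensor square of T, so A(u) z = z
    + (T : z) T, where T : z is [tr z + c p u * quad u z]. The quadratic form in [AformE] has the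
    same origin. *)
Lemma AapplyE p u z la j : Aapply p u z la j =
  z la j + (kdelta R la j + c p u * (u j * u la)) * (tr z + c p u * quad u z).
Proof.
rewrite /Aapply /Acoef /c /tr /quad.
set n := (1 + sqnorm2 u)^-1; set d := 2 * p / (2 - p).
rewrite !big_ord_recl !big_ord0 /=.
elim/ord2_ind: la; elim/ord2_ind: j; rewrite /kdelta /=; ring.
Qed.

Lemma AformE p u z : Aform p u z z =
  sqnormM z + (tr z + c p u * quad u z) ^+ 2.
Proof.
rewrite /Aform /Acoef /c /tr /quad /sqnormM.
set n := (1 + sqnorm2 u)^-1; set d := 2 * p / (2 - p).
rewrite !big_ord_recl !big_ord0 /= /kdelta /=; ring.
Qed.

Lemma mg_ge0 p (g : R -> R) : 1 < p -> 0 <= mg p g.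
Proof.
move=> p1; rewrite /mg mulr_ge0 ?invr_ge0 ?subr_ge0 ?(ltW p1)// addr_ge0//.
set A := (X in sup X); have [hA|nA] := pselect (has_sup A); last first.
  by rewrite sup_out. (* junk value [0] when the set is unbounded *)
(* For negative [s] the expression can be negative; at [s = 0] it reduces to |g'(0)|, a nonnegative
   lower bound for the supremum. *)
have : A (`|derive1 g 0| + 2 * `|derive1n 2 g 0| * 0) by exists 0.
move=> /(ub_le_sup hA.2); apply: le_trans.
by rewrite mulr0 addr0.
Qed.

(** With w = 1/r, the matrix Du = w (I - u u^T) has trace w, kills u and satisfies |Du|^2 = w^2 >=
    1. Hence g contributes 0, T : Du = w, A(u)(Du, Du) = 2 w^2, and A(u) Du = w (2 I + (c - 1) u
    u^T) with c = p/(2-p). *)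
Lemma avec_uhedge p (g : R -> R) x la j : 1 < p < 2 ->
  (forall r, 1 <= `|r| -> g r = 0) -> Bdisc x ->
  let K := (mg p g * 2) `^ ((p - 2) / 2) in
  avec p g (uhedge x) (dhedge x) la j =
  flux (2 * K) (K * (p / (2 - p) - 1)) ((1 - p) / 2) la j x.
Proof.
move=> /andP[p1 p2] g0 xB K; rewrite /avec AapplyE AformE.
have p2n : 2 - p != 0 by rewrite subr_eq0 gt_eqF.
(* At the origin all powers of [nsq] have nonzero exponents and are 0, so both sides vanish. *)
have := nsq_ge0 x; rewrite le_eqVlt => /predU1P[|x0].
  move=> /esym; move=> q0; have := q0 => /eqP; rewrite paddr_eq0 ?sqr_ge0// !sqrf_eq0.
  move=> /andP[/eqP x1 /eqP x2].
  have dz k i : dhedge x k i = 0.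
    by rewrite /dhedge q0 !powR0 ?mulr0 ?addr0//; lra.
  rewrite /flux q0 !powR0 ?mulr0 ?addr0//; [|lra|lra].
  by rewrite /tr /quad !big_ord_recl !big_ord0 !dz !(mulr0, addr0).
pose w := nsq x `^ (- 2^-1).
have w2 : w ^+ 2 = (nsq x)^-1.
  rewrite -powR_mulrn ?powR_ge0// /w -powRrM -(powR_inv1 (nsq_ge0 x)).
  congr (_ `^ _); lra.
have w3 : nsq x `^ (- 2^-1 - 1) = w ^+ 3.
  rewrite powRD ?(gt_eqF x0) ?implybT// powR_inv1 ?nsq_ge0// -w2 -/w; ring.
(* The components of the unit vector u; the contractions below are polynomials in them that simplify
   through [ab]. *)
pose a := x.1 * w; pose b := x.2 * w.
have ab : a ^+ 2 + b ^+ 2 = 1.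
  have -> : a ^+ 2 + b ^+ 2 = nsq x * w ^+ 2 by rewrite /a /b /nsq; ring.
  by rewrite w2 mulfV// gt_eqF.
have u0 : uhedge x ord0 = a by rewrite uhedgeE.
have u1 : uhedge x (lift ord0 ord0) = b by rewrite uhedgeE.
have dE k i : dhedge x k i = w * (kdelta R k i - uhedge x k * uhedge x i).
  by rewrite /dhedge w3 -/w !uhedgeE -/w; field.
have nu : sqnorm2 (uhedge x) = 1 by rewrite /sqnorm2 !big_ord_recl big_ord0 u0 u1 addr0.
have trE : tr (dhedge x) = w.
  rewrite /tr !dE u0 u1 /kdelta /=.
  transitivity (w * (2 - (a ^+ 2 + b ^+ 2))); first ring.
  by rewrite ab; ring.
have quadE : quad (uhedge x) (dhedge x) = 0.
  rewrite /quad !big_ord_recl !big_ord0 /= !dE u0 u1 /kdelta /=.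
  transitivity (w * ((a ^+ 2 + b ^+ 2) - (a ^+ 2 + b ^+ 2) ^+ 2)); first ring.
  by rewrite ab; ring.
have sqE : sqnormM (dhedge x) = w ^+ 2.
  rewrite /sqnormM !big_ord_recl !big_ord0 /= !dE u0 u1 /kdelta /=.
  transitivity (w ^+ 2 * (2 - 2 * (a ^+ 2 + b ^+ 2) + (a ^+ 2 + b ^+ 2) ^+ 2)).
    ring.
  by rewrite ab; ring.
rewrite trE quadE sqE mulr0 addr0 g0; last first.
  rewrite w2 ger0_norm ?invr_ge0 ?nsq_ge0// invf_ge1//; exact: ltW.
rewrite add0r dE /c nu.
have -> : mg p g * (w ^+ 2 + w ^+ 2) = (mg p g * 2) * w ^+ 2 by ring.
(* The power of a product splits for nonnegative factors; here the sign of [mg] enters. *)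
have m2 : 0 <= mg p g * 2 by rewrite mulr_ge0 ?mg_ge0.
rewrite (powRM _ m2 (sqr_ge0 w)) -/K.
(* The scalar factor of the stress is of order r^(2-p); the factor w from A(u) Du then lowers it to
   r^(1-p). *)
have -> : (w ^+ 2) `^ ((p - 2) / 2) = nsq x `^ ((2 - p) / 2).
  rewrite w2 -(powR_inv1 (nsq_ge0 x)) -powRrM; congr (_ `^ _); lra.
have qb : nsq x `^ ((1 - p) / 2) = nsq x `^ ((2 - p) / 2) * w.
  rewrite -powRD ?(gt_eqF x0) ?implybT//; congr (_ `^ _); lra.
rewrite /flux powRB ?(gt_eqF x0) ?implybT// powRr1 ?nsq_ge0// -w2 qb !uhedgeE -/w.
by field; rewrite p2n.
Qed.

End stress.

(** * Assembling the weak equation *)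

Unset Implicit Arguments.
Set Strict Implicit.

Theorem theorem3p5 (R : realType) (p : R) (g : R -> R) :
  1 < p -> p < 2 ->
  smooth1 g ->
  (forall s, g (- s) = g s) ->
  (forall s, 0 <= g s <= 1) ->
  (forall s, (if s == 0 then 1 else 0) <= g s <= (if `|s| < 1 then 1 else 0)) ->
  (forall k : 'I_2, inLp p (fun x => @uhedge R x k)) /\
  (forall k : 'I_2, inLinfty (fun x => @uhedge R x k)) /\
  exists Du : R * R -> 'I_2 -> 'I_2 -> R,
    weak_gradient (@uhedge R) Du /\
    (forall k i : 'I_2, inLp p (fun x => Du x k i)) /\
    forall phi : 'I_2 -> R * R -> R, (forall k, test_fun (phi k)) ->
      let integrand := fun x =>
        \sum_(la < 2) \sum_(j < 2)
          avec p g (@uhedge R x) (Du x) la j * pderiv j (phi la) x in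
      (@leb2 R).-integrable (@Bdisc R) (EFin \o integrand) /\
      (\int[@leb2 R]_(x in @Bdisc R) (integrand x)%:E = 0)%E.
Proof.
move=> p1 p2 sg gsym g01 gind.
have p12 : 1 < p < 2 by rewrite p1.
have s01 : 0 < p / 2 < 1 by apply/andP; split; lra.
have g0 r : 1 <= `|r| -> g r = 0.
  move=> r1; have /andP[_] := gind r; rewrite ltNge r1 /= => gr.
  by apply/eqP; rewrite eq_le gr /=; have /andP[] := g01 r.
split; first by move=> k; apply: dominated_inLp => //; apply: uhedge_dominated.
split.
  (* Domination with exponent 0 is boundedness: every base to the power 0 is 1, even the base 0. *)
  move=> k; have [mu [C uC]] := @uhedge_dominated R 0 k (lexx 0).
  split; first exact: measurable_funTS.
  by exists C; apply: aeW => x xB; have := uC x xB; rewrite oppr0 powRr0 mulr1.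
exists (@dhedge R); split.
  move=> k i psi tpsi.
  (* The gradient admits any exponent in [1/2, 1), and [p / 2] lies there. *)
  have [] := @dominated_integration_by_parts R _ s01 i (fun x => uhedge x k)
    (fun x => dhedge x k i) psi _ _ _ tpsi.
  - by apply: uhedge_dominated; lra.
  - by apply: dhedge_dominated; lra.
  - exact: uhedge_is_derive_line.
  - by move=> *; split.
split; first by move=> k i; apply: dominated_inLp => //; apply: dhedge_dominated.
move=> phi tphi integrand.
pose K := (mg p g * 2) `^ ((p - 2) / 2).
pose F := @flux R (2 * K) (K * (p / (2 - p) - 1)) ((1 - p) / 2).
pose G := @dflux R (2 * K) (K * (p / (2 - p) - 1)) ((1 - p) / 2).
have ibp la j := @dominated_integration_by_parts R _ s01 j (F la j) (G la j) (phi la)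
   (flux_dominated _ _ la j p12) (dflux_dominated _ _ la j p12)
   (flux_is_derive_line _ _ _ la j) (tphi la).
have mB := @measurable_Bdisc R.
(* The stress is identified with [F] only in the disc: outside it |Du| <= 1 and [g] may
   contribute. *)
have intE x : Bdisc x -> integrand x =
    \sum_(la < 2) \sum_(j < 2) F la j x * pderiv j (phi la) x.
  move=> xB; rewrite /integrand; apply: eq_bigr => la _; apply: eq_bigr => j _.
  by rewrite avec_uhedge.
have int1 la j : (@leb2 R).-integrable (@Bdisc R)
    (fun x => (F la j x * pderiv j (phi la) x)%:E) by have [] := ibp la j.
have int2 la j : (@leb2 R).-integrable (@Bdisc R)
    (fun x => (G la j x * phi la x)%:E) by have [] := ibp la j.
have int1s la : (@leb2 R).-integrable (@Bdisc R)
    (fun x => (\sum_(j < 2) (F la j x * pderiv j (phi la) x)%:E)%E).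
  exact: integrable_sum.
have intE' : {in @Bdisc R, (fun x => (\sum_(la < 2) \sum_(j < 2)
    (F la j x * pderiv j (phi la) x)%:E)%E) =1 EFin \o integrand}.
  move=> x /set_mem xB /=; rewrite intE// -sumEFin; apply: eq_bigr => la _.
  by rewrite -sumEFin.
split.
  have := @eq_integrable _ _ R (@leb2 R) (@Bdisc R) mB _ _ intE'; apply.
  by apply: integrable_sum => // la _; exact: int1s.
transitivity (\int[@leb2 R]_(x in @Bdisc R)
    (\sum_(la < 2) \sum_(j < 2) (F la j x * pderiv j (phi la) x)%:E))%E.
  by apply: eq_integral => x xB; rewrite intE'.
rewrite integral_sum//.
rewrite big1// => la _; rewrite integral_sum//.
(* Integration by parts acts on each entry separately; the divergence vanishes pointwise only after
   summation over [j]. *)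
have GE : (\sum_(j < 2) \int[@leb2 R]_(x in @Bdisc R) (G la j x * phi la x)%:E = 0)%E.
  rewrite -integral_sum// -[RHS](integral0 (@leb2 R) (@Bdisc R)).
  apply: eq_integral => x _; rewrite sumEFin -mulr_suml dflux_div ?mul0r//.
  (* Here 2b = 1 - p, and (1 - p) 2K + (2 - p) K (p/(2-p) - 1) = 0. *)
  by field; lra.
have fin j := @integrable_fin_num _ _ R (@leb2 R) _ mB _ (int2 la j).
transitivity (\sum_(j < 2) - \int[@leb2 R]_(x in @Bdisc R) (G la j x * phi la x)%:E)%E.
  by apply: eq_bigr => j _; have [_ _] := ibp la j.
by rewrite fin_num_sumeN ?GE ?oppe0// => j _; exact: fin.
Qed.
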